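(* Let $k,d$ be positive integers and let $G$ be a graph of order $n$ that is $(k,d)$-special. Then $b_k(G) \leq \left\lceil \frac{n}{k} \right\rceil + d$.
   Context: All graphs are finite, simple and undirected. A graph $G$ on $n$ vertices is $(k,d)$-special if $V(G)$ can be partitioned into sets $S_1,\dots,S_{\lceil n/k\rceil}$, all of cardinality $k$ with at most one exception, such that each $S_i$ has diameter at most $d$ with respect to distance in $G$ (i.e. $d_G(u,v)\le d$ for all $u,v\in S_i$). $k$-liminal burning game on $G$ ($k$ a positive integer): two players, Saboteur and Arsonist. Each vertex is burned or unburned, and revealed or unrevealed; initially all are unburned and unrevealed. In each round: (i) propagation: every unburned vertex with a neighbor burned in an earlier round becomes burned (whether revealed or not); (ii) the Saboteur reveals $k$ vertices that are unrevealed and unburned (all such vertices if fewer than $k$ exist); revealed vertices stay revealed; (iii) the Arsonist burns one revealed unburned vertex (revealed in this or any earlier round), if one exists. The game ends in the round in which all vertices are burned. The Saboteur maximizes and the Arsonist minimizes the number of rounds; $b_k(G)$ is the number of rounds under optimal play. *)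

(* Defs.v *)
From mathcomp Require Import all_boot.
From mathcomp Require Import zify.

Set Implicit Arguments.
Unset Strict Implicit.
Unset Printing Implicit Defensive.

Section Distance.
Variables (T : finType) (e : rel T).

Definition walk (u v : T) (m : nat) : bool :=
  [exists p : m.-tuple T, path e u p && (last u p == v)].

Lemma connect_walk u v : connect e u v -> exists m, walk u v m.
Proof.
case/connectP=> p pth ->; exists (size p).
by apply/existsP; exists (in_tuple p); rewrite pth eqxx.
Qed.

(* [None] is the infinite distance, between vertices of distinct components. *)
Definition dist (u v : T) : option nat :=
  match boolP (connect e u v) with
  | AltTrue uv => Some (ex_minn (connect_walk uv))
  | AltFalse _ => None
  end.

Definition diam_le (S : {set T}) (d : nat) : bool :=
  [forall u in S, forall v in S, if dist u v is Some m then m <= d else false].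

End Distance.

Definition ceil_div (n k : nat) : nat := (n + k.-1) %/ k.

(* The blocks of a [partition] are nonempty; this excludes nothing, since
   ceil(n/k) sets with total size n, all but at most one of size k > 0, are
   automatically nonempty. *)
Definition special (T : finType) (e : rel T) (k d : nat) : Prop :=
  exists P : {set {set T}},
    [/\ partition P [set: T],
        #|P| = ceil_div #|T| k,
        #|[set S in P | #|S| != k]| <= 1
      & forall S, S \in P -> diam_le e S d].

Section Game.
Variables (T : finType) (e : rel T) (k : nat).

Implicit Types (B R X : {set T}) (m : nat).

Definition propagate B : {set T} := B :|: [set v | [exists u in B, e u v]].

Definition reveal_legal B R X : bool :=
  (X \subset ~: (B :|: R)) && (#|X| == minn k #|~: (B :|: R)|).

(* The minimum of F over A, and x0 if A is empty. *)
Definition min_over (A : {set T}) (F : T -> nat) (x0 : nat) : nat :=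
  if [pick v in A] is Some v0 then F [arg min_(v < v0 in A) F v] else x0.

(* Minimax number of rounds still to be played when B is the set of burned
   vertices and R the set of revealed ones at the end of a round, the play
   being cut off after m more rounds. The default of [min_over] is the
   Arsonist passing, when every revealed vertex is already burned. *)
Fixpoint rounds m B R : nat :=
  if B == [set: T] then 0 else
  if m is m'.+1 then
    let B' := propagate B in
    (\max_(X : {set T} | reveal_legal B' R X)
       min_over ((R :|: X) :\: B')
         (fun v => rounds m' (v |: B') (R :|: X))
         (rounds m' B' (R :|: X))).+1
  else 0.

(* For k > 0 every round burns a new vertex, so that cutting off after #|T|
   rounds never shortens a game: see [rounds_stable]. *)
Definition burning_number : nat := rounds #|T| set0 set0.

Lemma min_over_ext (A : {set T}) F G x y :
  {in A, F =1 G} -> (A = set0 -> x = y) -> min_over A F x = min_over A G y.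
Proof.
move=> FG xy; rewrite /min_over; case: pickP => [v0 v0A | A0]; last first.
  by apply/xy/setP=> v; rewrite inE; apply: A0.
case: arg_minnP => // v vA vmin; case: arg_minnP => // w wA wmin.
apply/eqP; rewrite eqn_leq FG // wmin // andbT.
by rewrite -(FG _ vA) -(FG _ wA) vmin.
Qed.

Lemma rounds_stable m1 m2 B R : 0 < k ->
  #|~: B| <= m1 -> #|~: B| <= m2 -> rounds m1 B R = rounds m2 B R.
Proof.
move=> k0; elim: m1 m2 B R => [|m1 IH] m2 B R h1 h2.
  have /eqP BT : B == [set: T].
    by move: h1; rewrite leqn0 cards_eq0 -setCT (inj_eq (@setC_inj T)).
  by case: m2 {h2} => [|m2] /=; rewrite BT eqxx.
have [BT|BT] := eqVneq B [set: T].
  by case: m2 {h2} => [|m2] /=; rewrite BT eqxx.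
have cB : 0 < #|~: B| by rewrite card_gt0 -setCT (inj_eq (@setC_inj T)).
case: m2 h2 => [|m2] h2; first lia.
rewrite /= (negPf BT); congr S; apply: eq_bigr => X /andP[XS /eqP cX].
have sub : B \subset propagate B by apply: subsetUl.
apply: min_over_ext => [v|A0].
  rewrite inE => /andP[vB _].
  have : #|~: (v |: propagate B)| < #|~: B|.
    apply: proper_card; apply/properP; split.
      by rewrite setCS (subset_trans sub) // subsetUr.
    exists v; rewrite !inE ?eqxx //.
    by apply: contra vB; apply: (subsetP sub).
  by move=> h; apply: IH; lia.
suff BT' : propagate B = [set: T] by case: (m1) (m2) => [|?] [|?] /=; rewrite BT' eqxx.
have /eqP := A0; rewrite setD_eq0 subUset => /andP[RB XB].
have X0 : X = set0.
  apply/setP=> v; rewrite inE; apply/negP=> vX.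
  by have := subsetP XS v vX; rewrite in_setC in_setU (subsetP XB v vX).
have : ~: (propagate B :|: R) == set0.
  by move: cX; rewrite X0 cards0 -cards_eq0; lia.
by rewrite (setUidPl RB) -setCT (inj_eq (@setC_inj T)) => /eqP.
Qed.

End Game.

(* Main.v *)
Require Import Defs.
From mathcomp Require Import all_boot.
From mathcomp Require Import zify.

Set Implicit Arguments.
Unset Strict Implicit.
Unset Printing Implicit Defensive.

(** Call a block of the partition hit once it contains a burned vertex. In each
    round the Arsonist burns a revealed vertex of a block not yet hit, whenever
    there is one. After [i] rounds at least [i] blocks are hit (or all of them):
    if in round [i] all revealed vertices lie in hit blocks, then either
    [i * k] vertices are revealed, and as blocks have at most [k] vertices there
    are at least [i] hit blocks, or every unburned vertex is revealed, and every
    block is hit. So all [ceil(n/k)] blocks are hit after [ceil(n/k)] rounds, and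
    propagation alone burns the remaining vertices in [d] more rounds. *)

Lemma ceil_div_mul_ge n k : 0 < k -> n <= ceil_div n k * k.
Proof.
move=> k0; rewrite /ceil_div.
by have := divn_eq (n + k.-1) k; have := ltn_pmod (n + k.-1) k0; lia.
Qed.

Lemma dist_walk (T : finType) (e : rel T) u v m :
  dist e u v = Some m -> walk e u v m.
Proof.
rewrite /dist; move: (boolP _) => c.
(* Only the index of [alt_spec] is generalized, which makes the case analysis on [c] well typed. *)
by move: {3}(connect e u v) c => b; case=> // uv [<-]; case: ex_minnP.
Qed.

(** A block larger than [k] would be the exceptional one; all others having exactly [k] vertices,
    the total would exceed [ceil_div #|T| k * k], which is at least [#|T|]. *)
Lemma special_block_le (T : finType) (k : nat) (P : {set {set T}}) : 0 < k ->
  partition P [set: T] -> #|P| = ceil_div #|T| k ->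
  #|[set S in P | #|S| != k]| <= 1 ->
  {in P, forall S : {set T}, #|S| <= k}.
Proof.
move=> k0 partP cP exc S SP; rewrite leqNgt; apply/negP=> kS.
have SE : S \in [set S in P | #|S| != k] by rewrite inE SP; lia.
have others S' : S' \in P -> S' != S -> #|S'| = k.
  move=> S'P; apply: contraNeq => S'k.
  by apply/eqP/(card_le1_eqP exc); rewrite // inE S'P.
have := card_partition partP; rewrite cardsT (big_setD1 S) //=.
rewrite (eq_bigr (fun=> k)); last by move=> S' /setD1P[S'S S'P]; apply: others.
rewrite sum_nat_const; have := ceil_div_mul_ge #|T| k0.
rewrite -cP (cardsD1 S P) SP => + h.
by rewrite h mulnDl mul1n leq_add2r leqNgt kS.
Qed.

Section Strategy.
Variables (T : finType) (e : rel T) (k : nat).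
Implicit Types (B R X A : {set T}).

Lemma min_over_le A F x c :
  (A = set0 -> x <= c) -> (A != set0 -> exists2 v, v \in A & F v <= c) ->
  min_over A F x <= c.
Proof.
rewrite /min_over => h0 h1; case: pickP => [v0 v0A | A0]; last first.
  by apply/h0/setP=> v; rewrite inE; apply: A0.
case: h1 => [|w wA Fw]; first by apply/set0Pn; exists v0.
by case: arg_minnP => // v _ vmin; apply: leq_trans (vmin _ wA) Fw.
Qed.

Lemma rounds_step m B R c :
  (forall X, reveal_legal k (propagate e B) R X ->
     min_over ((R :|: X) :\: propagate e B)
       (fun v => rounds e k m (v |: propagate e B) (R :|: X))
       (rounds e k m (propagate e B) (R :|: X)) <= c) ->
  rounds e k m.+1 B R <= c.+1.
Proof. by move=> h /=; case: ifP => // _; rewrite ltnS; apply/bigmax_leqP. Qed.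

(** The paths start in [B], so that one propagation removes their first edge. *)
Definition within t B : Prop := forall v,
  exists u p, [/\ u \in B, path e u p, last u p = v & size p <= t].

Lemma within_mono t B B' : B \subset B' -> within t B -> within t B'.
Proof.
move=> sub wB v; have [u [p [uB pp lp sp]]] := wB v.
by exists u, p; split=> //; apply: (subsetP sub).
Qed.

Lemma within_propagate t B : within t.+1 B -> within t (propagate e B).
Proof.
move=> wB v; have [u [[|x p] [uB /= pp lp sp]]] := wB v.
  by exists u, [::]; split=> //; rewrite inE uB.
case/andP: pp => ux pp; exists x, p; split=> //.
by rewrite !inE; apply/orP; right; apply/existsP; exists u; rewrite uB.
Qed.

(** Each propagation lowers the distance bound by one, and any extra burned vertex only helps. The
    cut-off [m] is arbitrary, since stopping early only lowers the count. *)
Lemma rounds_within t m B R : within t B -> rounds e k m B R <= t.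
Proof.
elim: t m B R => [|t IH] [|m] B R wB; try by rewrite /=; case: ifP.
  suff -> : B = [set: T] by rewrite /= eqxx.
  apply/setP=> v; have [u [[|x p] [uB _ /= <- // _]]] := wB v.
  by rewrite uB inE.
apply: rounds_step => X _; have wB' := within_propagate wB.
apply: min_over_le => [_|/set0Pn[v vA]]; first exact: IH.
by exists v => //; apply/IH/(within_mono _ wB')/subsetUr.
Qed.

Variable P : {set {set T}}.
Hypothesis partP : partition P [set: T].
Hypothesis blocks_le : {in P, forall S : {set T}, #|S| <= k}.

Definition hit B : {set {set T}} := [set S in P | ~~ [disjoint S & B]].

Lemma hit_mono B B' : B \subset B' -> hit B \subset hit B'.
Proof.
move=> sub; apply/subsetP=> S; rewrite !inE => /andP[-> /=].
by apply: contra; apply: disjointWr.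
Qed.

Lemma pblockT v : pblock P v \in P /\ v \in pblock P v.
Proof.
have vP : v \in cover P by rewrite (cover_partition partP).
by rewrite pblock_mem // mem_pblock.
Qed.

Lemma hit_pblock B v : v \in B -> pblock P v \in hit B.
Proof.
have [bP vb] := pblockT v => vB; rewrite inE bP /=.
by apply/pred0Pn; exists v; rewrite /= vb.
Qed.

Lemma card_hit_cover B : #|cover (hit B)| <= #|hit B| * k.
Proof.
apply: leq_trans (leq_card_cover _) _; rewrite -sum_nat_const.
by apply: leq_sum => S; rewrite inE => /andP[/blocks_le].
Qed.

Lemma hit_full B : #|P| <= #|hit B| -> hit B = P.
Proof.
move=> h; apply/eqP; rewrite eqEcard h andbT.
by apply/subsetP=> S /[!inE] /andP[].
Qed.

(** The second alternative records that the Saboteur has run out of vertices to reveal. *)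
Definition revealed_enough i B R := i * k <= #|R| \/ B :|: R = [set: T].

Lemma revealed_enough_mono i B B' R :
  B \subset B' -> revealed_enough i B R -> revealed_enough i B' R.
Proof.
move=> sub [h|h]; [by left | right; apply/eqP].
by rewrite -subTset -h setSU.
Qed.

Lemma revealed_enough_reveal i B R X :
  reveal_legal k B R X -> revealed_enough i B R ->
  revealed_enough i.+1 B (R :|: X).
Proof.
case/andP=> XS /eqP cX [h|h]; last first.
  by right; apply/eqP; rewrite setUA h -subTset subsetUl.
have [le_k|gt_k] := leqP k #|~: (B :|: R)|; [left | right].
  rewrite mulSn cardsU (_ : R :&: X = set0) ?cards0; first by lia.
  apply/setP=> v; rewrite !inE; apply/negP=> /andP[vR /(subsetP XS)].
  by rewrite !inE vR orbT.
have -> : X = ~: (B :|: R) by apply/eqP; rewrite eqEcard XS cX; lia.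
by rewrite setUA setUCr.
Qed.

(** The bound [i <= #|P|] serves the second alternative of [revealed_enough], where all blocks turn
    out to be hit. *)
Lemma hit_stuck i B R : i <= #|P| ->
  revealed_enough i B R -> R \subset cover (hit B) -> 0 < k -> i <= #|hit B|.
Proof.
move=> iP [h|h] sub k0.
  rewrite -(leq_pmul2r k0).
  exact: leq_trans h (leq_trans (subset_leq_card sub) (card_hit_cover B)).
apply: leq_trans iP _; apply/subset_leq_card/subsetP=> S SP.
have /set0Pn[v vS] : S != set0.
  by apply: contraTneq SP => ->; case/and3P: partP.
have /setUP[vB|/(subsetP sub)/bigcupP[S' S'H vS']] : v \in B :|: R.
- by rewrite h inE.
- by rewrite inE SP; apply/pred0Pn; exists v; rewrite /= vS.
(* A revealed vertex of [S] lies in a hit block [S']; blocks being disjoint, [S] is [S']. *)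
have S'P : S' \in P by move: S'H; rewrite inE => /andP[].
have tI : trivIset P by case/and3P: partP.
by rewrite -(def_pblock tI SP vS) (def_pblock tI S'P vS').
Qed.

(** Induction on [j], the rounds left until all blocks are hit, with [i] counting those already
    played. *)
Lemma rounds_hit d i j m B R : 0 < k ->
  {in P, forall S, diam_le e S d} -> i + j = #|P| ->
  i <= #|hit B| -> revealed_enough i B R -> rounds e k m B R <= j + d.
Proof.
move=> k0 diamP; elim: j i m B R => [|j IH] i m B R.
  rewrite addn0 => -> /hit_full hB _; apply: rounds_within => v.
  have [bP vb] := pblockT v.
  have : pblock P v \in hit B by rewrite hB.
  rewrite inE bP /= => /pred0Pn[u /= /andP[ub uB]].
  move/forall_inP: (diamP _ bP) => /(_ u ub)/forall_inP/(_ v vb).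
  case D: (dist e u v) => [l|//] ld.
  have /existsP[p /andP[pp /eqP lp]] := dist_walk D.
  by exists u, p; split=> //; rewrite size_tuple.
rewrite addnS -addSn => iP hitB enough.
case: m => [|m]; first by rewrite /=; case: ifP.
rewrite addSn; apply: rounds_step => X legal.
set B' := propagate e B in legal *; set R' := R :|: X.
have BB' : B \subset B' by apply: subsetUl.
have enough' : revealed_enough i.+1 B' R'.
  exact/(revealed_enough_reveal legal)/(revealed_enough_mono BB').
have hitB' : i <= #|hit B'|.
  by apply: leq_trans hitB _; apply/subset_leq_card/hit_mono.
have iP' : i.+1 <= #|P| by lia.
have stuck : R' \subset cover (hit B') -> i.+1 <= #|hit B'|.
  by move=> sub; apply: hit_stuck enough' sub k0.
have burned_covered v : v \in B' -> v \in cover (hit B').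
  move=> vB; apply/bigcupP; exists (pblock P v); first exact: hit_pblock.
  by case: (pblockT v).
(* If nothing can be burned, all revealed vertices are burned, hence in hit blocks, and [stuck]
   applies. *)
apply: min_over_le => [/eqP|/set0Pn[w wA]].
  rewrite setD_eq0 => /subsetP sub; apply: (IH i.+1) => //; apply: stuck.
  by apply/subsetP=> v /sub/burned_covered.
(* When the revealed vertices all lie in hit blocks, [stuck] already gives [i.+1] and any [w] will
   do. Otherwise [v] lies in a block not yet hit, so it is unburned and burning it hits a new
   block. *)
have [cov|/subsetPn[v vR vH]] := boolP (R' \subset cover (hit B')).
  exists w => //; apply: (IH i.+1) => //.
    by apply: leq_trans (stuck cov) _; apply/subset_leq_card/hit_mono/subsetUr.
  by apply: revealed_enough_mono enough'; apply: subsetUr.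
exists v; first by rewrite inE vR andbT; apply: contra vH => /burned_covered.
apply: (IH i.+1) => //; last first.
  by apply: revealed_enough_mono enough'; apply: subsetUr.
apply: leq_ltn_trans hitB' _; apply/proper_card/properP; split.
  exact/hit_mono/subsetUr.
exists (pblock P v); first by apply/hit_pblock/setU11.
apply: contra vH => bH; apply/bigcupP; exists (pblock P v) => //.
by case: (pblockT v).
Qed.

End Strategy.

Theorem theorem16 (T : finType) (e : rel T)
  (e_sym : symmetric e) (e_irr : irreflexive e)
  (k d : nat) (k_gt0 : 0 < k) (d_gt0 : 0 < d) (G_special : special e k d) :
  burning_number e k <= ceil_div #|T| k + d.
Proof.
have [P [partP cP exc diamP]] := G_special.
have blocks_le := special_block_le k_gt0 partP cP exc.
by rewrite -cP; apply: (rounds_hit partP blocks_le (i := 0)) => //; left.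
Qed.
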